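(* Let $A,B,C,D,E,F\in\mathbb{R}$ with $A\neq 0$, $B\neq 0$, $C\neq 0$, and consider the conic $$\mathcal{K}=\{(x,y)\in\mathbb{R}^2 : Ax^2+2Bxy+Cy^2+2Dx+2Ey+F=0\}.$$ Suppose that the vectors $\binom{A}{B},\binom{B}{C}$ are linearly dependent, i.e. $\delta=\begin{vmatrix} A & B \\ B & C \end{vmatrix}=AC-B^2=0$, and that $\binom{-D}{-E}$ does not belong to the span of $\binom{A}{B}$, i.e. $\binom{A}{B},\binom{-D}{-E}$ are linearly independent, so that $\begin{vmatrix} A & -D \\ B & -E \end{vmatrix}=BD-AE\neq 0$. Then $\mathcal{K}$ is a parabola, and $$\Delta=\begin{vmatrix} A & B & D \\ B & C & E \\ D & E & F \end{vmatrix}\neq 0.$$ *)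

(* Defs.v *)
From HB Require Import structures.
From mathcomp Require Import all_boot all_order all_algebra.
From mathcomp Require Import classical_sets reals.

Set Implicit Arguments.
Unset Strict Implicit.
Unset Printing Implicit Defensive.

Import Order.TTheory GRing.Theory Num.Theory.

Local Open Scope ring_scope.
Local Open Scope classical_set_scope.

Definition vec2 (R : realType) (a b : R) : 'cV[R]_2 :=
  \col_i nth 0 [:: a; b] i.

Definition mx_of_rows (R : realType) (n : nat) (rows : seq (seq R)) : 'M[R]_n :=
  \matrix_(i, j) nth 0 (nth [::] rows i) j.

Definition conic (R : realType) (A B C D E F : R) : set (R * R) :=
  [set p | A * p.1 ^+ 2 + 2 * B * p.1 * p.2 + C * p.2 ^+ 2
           + 2 * D * p.1 + 2 * E * p.2 + F = 0].

(* The Euclidean distance; the library's norm on [R * R] is the sup norm. *)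
Definition dist2 (R : realType) (p q : R * R) : R :=
  Num.sqrt ((p.1 - q.1) ^+ 2 + (p.2 - q.2) ^+ 2).

(* Euclidean distance from [p] to the line [a * x + b * y + c = 0]; it is
   meaningful only when [(a, b) != (0, 0)]. *)
Definition dist_line (R : realType) (a b c : R) (p : R * R) : R :=
  `|a * p.1 + b * p.2 + c| / Num.sqrt (a ^+ 2 + b ^+ 2).

(* Focus-directrix definition.  The focus [f] must lie off the directrix
   [a * x + b * y + c = 0]: otherwise the locus is a straight line. *)
Definition is_parabola (R : realType) (K : set (R * R)) : Prop :=
  exists (f : R * R) (a b c : R),
    [/\ (a, b) != (0, 0),
        a * f.1 + b * f.2 + c != 0
      & K = [set p | dist2 p f = dist_line a b c p]].

(* Main.v *)
Require Import Defs.
From mathcomp Require Import all_boot all_order all_algebra.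
From mathcomp Require Import classical_sets reals.
From mathcomp Require Import ring.

Import Order.TTheory GRing.Theory Num.Theory.

Local Open Scope ring_scope.

(** Since [A * C = B ^+ 2], multiplying the equation of the conic by [A] turns
    its quadratic part into [(A * x + B * y) ^+ 2], so the axis is parallel to
    [A * x + B * y = 0] and the directrix has the form [B * x - A * y + c = 0].
    Comparing coefficients determines the focus from [c], and [c] is the root
    of a linear equation with leading coefficient [2 * A * (B * D - A * E)].
    The value of the directrix form at the focus is a nonzero multiple of
    [B * D - A * E], and [A * Delta = - (B * D - A * E) ^+ 2]. *)

Lemma det_mx_of_rows2 (R : realType) (a b c d : R) :
  \det (mx_of_rows 2 [:: [:: a; b]; [:: c; d]]) = a * d - b * c.
Proof.
rewrite (expand_det_row _ ord0) !big_ord_recl big_ord0 /cofactor !det_mx11.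
rewrite !mxE /= /bump /=; ring.
Qed.

Lemma det_mx_of_rows3 (R : realType) (a b c d e f g h i : R) :
  \det (mx_of_rows 3 [:: [:: a; b; c]; [:: d; e; f]; [:: g; h; i]]) =
  a * (e * i - f * h) - b * (d * i - f * g) + c * (d * h - e * g).
Proof.
rewrite (expand_det_row _ ord0) !big_ord_recl big_ord0 /cofactor.
rewrite !(expand_det_row _ ord0) !big_ord_recl !big_ord0 /cofactor !det_mx11.
rewrite !mxE /= /bump /=; ring.
Qed.

Lemma vec2_eq0 (R : realType) (a b : R) :
  (vec2 a b == 0) = (a == 0) && (b == 0).
Proof.
apply/eqP/andP => [/matrixP ab0|[/eqP-> /eqP->]].
  by have := (ab0 0 0, ab0 1 0); rewrite !mxE /= => -[-> ->].
by apply/matrixP => -[[|[|//]] ?] j; rewrite !mxE.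
Qed.

(** Collinearity with a nonzero vector is the vanishing of a 2 by 2 determinant. For the converse
    the scalar is a quotient by a nonzero coordinate of [vec2 c d], hence the case split on [c]. *)
Lemma vec2_line (R : realType) (a b c d : R) : vec2 c d != 0 ->
  (vec2 a b \in <[vec2 c d]>%VS) = (a * d == b * c).
Proof.
rewrite vec2_eq0 => cd0; apply/vlineP/eqP => [[k /matrixP abk]|adbc].
  have := (abk 0 0, abk 1 0); rewrite !mxE /= => -[-> ->]; ring.
have [c0|c0] := eqVneq c 0.
  have d0 : d != 0 by move: cd0; rewrite c0 eqxx.
  have a0 : a = 0 by apply: (mulIf d0); rewrite adbc c0 mulr0 mul0r.
  exists (b / d); apply/matrixP => -[[|[|//]] ?] j; rewrite !mxE /=.
    by rewrite a0 c0 mulr0.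
  by rewrite divfK.
exists (a / c); apply/matrixP => -[[|[|//]] ?] j; rewrite !mxE /=.
  by rewrite divfK.
by rewrite mulrAC adbc mulfK.
Qed.

Lemma free_vec2 (R : realType) (a b c d : R) : vec2 c d != 0 ->
  free [:: vec2 a b; vec2 c d] = (a * d != b * c).
Proof. by move=> cd0; rewrite free_cons span_seq1 seq1_free cd0 andbT vec2_line. Qed.

(** Both distances are nonnegative, so squaring loses nothing; clearing the denominator turns the
    focus-directrix condition into a polynomial equation. *)
Lemma dist2_eq_dist_line (R : realType) (a b c : R) (f p : R * R) :
  0 < a ^+ 2 + b ^+ 2 ->
  dist2 p f = dist_line a b c p <->
  (a ^+ 2 + b ^+ 2) * ((p.1 - f.1) ^+ 2 + (p.2 - f.2) ^+ 2) =
  (a * p.1 + b * p.2 + c) ^+ 2.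
Proof.
move=> N0; rewrite /dist2 /dist_line.
set S := _ + (p.2 - f.2) ^+ 2; set l := _ + c; set N := _ + b ^+ 2 in N0 *.
have S0 : 0 <= S by rewrite addr_ge0 ?sqr_ge0.
have sN0 : Num.sqrt N != 0 by rewrite gt_eqF // sqrtr_gt0.
rewrite -sqrtr_sqr -[in X in _ <-> X](sqr_sqrtr S0).
split=> [->|NS].
  by rewrite exprMn exprVn !sqr_sqrtr ?sqr_ge0 ?(ltW N0)// mulrC divfK ?gt_eqF.
apply: (mulIf sN0); rewrite divfK // -NS sqr_sqrtr // mulrC.
by rewrite sqrtrM ?(ltW N0).
Qed.

Lemma conic_parabola (R : realType) (A B C D E F : R) :
  A != 0 -> A * C = B ^+ 2 -> B * D - A * E != 0 ->
  is_parabola (conic A B C D E F).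
Proof.
move=> A0 AC m0.
have N0 : 0 < B ^+ 2 + (- A) ^+ 2.
  by rewrite sqrrN ltr_wpDl ?sqr_ge0 // exprn_even_gt0.
pose N := A ^+ 2 + B ^+ 2.
have NE : B ^+ 2 + (- A) ^+ 2 = N by rewrite sqrrN addrC.
have Nn0 : N != 0 by rewrite -NE gt_eqF.
(* The coefficients of [x] and [y] in [scaled_conic] below force [f]; its constant term, [constE],
   then forces [c]. *)
pose c := (N * F - A * (D ^+ 2 + E ^+ 2)) / (2 * (B * D - A * E)).
pose f := ((- (A * D) - B * c) / N, (A * c - A * E) / N).
have f1 : N * f.1 = - (A * D) - B * c by rewrite mulrC divfK.
have f2 : N * f.2 = A * c - A * E by rewrite mulrC divfK.
have cE : 2 * (B * D - A * E) * c = N * F - A * (D ^+ 2 + E ^+ 2).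
  by rewrite mulrC divfK // mulf_neq0 // pnatr_eq0.
have constE : N * (f.1 ^+ 2 + f.2 ^+ 2) - c ^+ 2 = A * F.
  (* After multiplication by [N] the focus enters only through [N * f.1] and [N * f.2]; the terms in
     [c ^+ 2] cancel, which leaves [A] times the linear equation [cE]. *)
  apply: (mulfI Nn0).
  have -> : N * (N * (f.1 ^+ 2 + f.2 ^+ 2) - c ^+ 2) =
    (N * f.1) ^+ 2 + (N * f.2) ^+ 2 - N * c ^+ 2 by ring.
  rewrite f1 f2; have -> : N * (A * F) =
    A * (2 * (B * D - A * E) * c + A * (D ^+ 2 + E ^+ 2)) by rewrite cE; ring.
  by rewrite /N; ring.
exists f, B, (- A), c; split.
- by rewrite xpair_eqE oppr_eq0 (negPf A0) andbF.
(* Multiplied by [- N], the value of the directrix form at the focus is [A * (B * D - A * E)]. *)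
- apply: contra_neq (mulf_neq0 A0 m0) => /(congr1 ( *%R (- N))).
  have -> : - N * (B * f.1 + - A * f.2 + c) =
    - (B * (N * f.1)) + A * (N * f.2) - N * c by ring.
  by rewrite mulr0 f1 f2 => <-; rewrite /N; ring.
have scaled_conic x y :
    N * ((x - f.1) ^+ 2 + (y - f.2) ^+ 2) - (B * x + - A * y + c) ^+ 2 =
    A * (A * x ^+ 2 + 2 * B * x * y + C * y ^+ 2 + 2 * D * x + 2 * E * y + F).
  have -> : N * ((x - f.1) ^+ 2 + (y - f.2) ^+ 2) - (B * x + - A * y + c) ^+ 2 =
    N * (x ^+ 2 + y ^+ 2) - 2 * x * (N * f.1) - 2 * y * (N * f.2)
    + (N * (f.1 ^+ 2 + f.2 ^+ 2) - c ^+ 2) + c ^+ 2 - (B * x + - A * y + c) ^+ 2.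
    by ring.
  (* [AC] matches the terms in [y ^+ 2]: [N - A ^+ 2 = B ^+ 2 = A * C]. *)
  by rewrite constE f1 f2 /N; ring: AC.
apply/seteqP; split=> -[x y] /=.
  move=> Kxy; apply/dist2_eq_dist_line => //=; rewrite NE.
  by apply/eqP; rewrite -subr_eq0 scaled_conic Kxy mulr0.
move/dist2_eq_dist_line => /(_ N0) /=; rewrite NE => eq_sq.
by apply: (mulfI A0); rewrite mulr0 -scaled_conic eq_sq subrr.
Qed.

Theorem mainTheorem2 (R : realType) (A B C D E F : R)
    (hA : A != 0) (hB : B != 0) (hC : C != 0)
    (hdep : ~~ free [:: vec2 A B; vec2 B C])
    (hspan : vec2 (- D) (- E) \notin <[vec2 A B]>%VS) :
  [/\ \det (mx_of_rows 2 [:: [:: A; B]; [:: B; C]]) = 0,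
      \det (mx_of_rows 2 [:: [:: A; - D]; [:: B; - E]]) != 0,
      is_parabola (conic A B C D E F)
    & \det (mx_of_rows 3 [:: [:: A; B; D]; [:: B; C; E]; [:: D; E; F]]) != 0].
Proof.
have AC : A * C = B ^+ 2.
  apply/eqP; move: hdep.
  by rewrite free_vec2 ?negbK ?expr2 // vec2_eq0 (negPf hB).
have m0 : B * D - A * E != 0.
  move: hspan; rewrite vec2_line ?vec2_eq0 ?(negPf hA) //.
  by apply: contraNneq => m0; rewrite -subr_eq0 -oppr_eq0 -m0; apply/eqP; ring.
rewrite !det_mx_of_rows2 det_mx_of_rows3; split.
- by rewrite AC expr2 subrr.
- by have -> : A * - E - - D * B = B * D - A * E by ring.
- exact: conic_parabola.
- apply: contra_neq m0 => Delta0; apply/eqP; rewrite -sqrf_eq0 -oppr_eq0.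
  (* Zero is rewritten as [A] times the determinant, so the goal becomes the identity for
     [A * Delta]. *)
  rewrite -(mulr0 A) -Delta0; apply/eqP; ring: AC.
Qed.
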